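(* Let $R$ be a Noetherian commutative ring with identity. Let $\mu_1,\dots,\mu_u,\nu_1,\dots,\nu_v$ be elements of $R$ and consider the ideals $I=(\mu_1,\dots,\mu_u)$ and $J=(\nu_1,\dots,\nu_v)$ of $R$. Suppose that there is a positive integer $s$ with $s<u$ and $s\leq v$ such that $$[\mu_1,\dots,\mu_s]\subset[\nu_1,\dots,\nu_s].$$ Adopt the convention that $\mu_h=0$ whenever $h>u$ and $\nu_k=0$ whenever $k>v$. For $1\leq i\leq u-s$ set $$\gamma_i=\sum_{j=s+1}^{s+i}\mu_j\nu_{i-j+s+1},$$ for $u-s+1\leq i\leq u$ set $$\gamma_i=\mu_{i-u+s}+\sum_{j=s+1}^{s+i}\mu_j\nu_{i-j+s+1},$$ and, if $s\leq v-2$, for $u+1\leq i\leq u+v-s-1$ set further $$\gamma_i=\sum_{j=s+1}^{s+i}\mu_j\nu_{i-j+s+1}.$$ Then, if $s\leq v-2$, $$\sqrt{I\cap J}=\sqrt{(\gamma_1,\dots,\gamma_{u+v-s-1})},$$ and, if $v-1\leq s\leq v$, $$\sqrt{I\cap J}=\sqrt{(\gamma_1,\dots,\gamma_u)}.$$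
   Context: For elements $\alpha_1,\dots,\alpha_t,\beta_1,\dots,\beta_t\in R$, one writes $[\alpha_1,\dots,\alpha_t]\subset[\beta_1,\dots,\beta_t]$ if, for all indices $i$ with $1\leq i\leq t$, there is an inclusion of ideals $(\alpha_1,\dots,\alpha_i)\subset(\beta_1,\dots,\beta_i)$ (not necessarily strict). $\sqrt{\cdot}$ denotes the radical of an ideal of $R$. *)

(* Defs.v *)
From mathcomp Require Import all_boot all_order all_algebra.
From mathcomp Require Import boolp classical_sets.
Set Implicit Arguments.
Unset Strict Implicit.
Unset Printing Implicit Defensive.
Import GRing.Theory.
Local Open Scope classical_set_scope.
Local Open Scope ring_scope.

Section Ideals.
Variable R : comPzRingType.
Implicit Types (I : set R) (a b : seq R).

(* The zero ring and the improper ideal are allowed, unlike in ring_quotient. *)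
Definition is_ideal I : Prop :=
  [/\ I 0, forall x y, I x -> I y -> I (x + y) & forall r x, I x -> I (r * x)].

Definition ideal_gen a : set R := smallest is_ideal [set x | x \in a].

Definition radical I : set R := [set x | exists2 n, (0 < n)%N & I (x ^+ n)].

(* [a_1, ..., a_t] \subset [b_1, ..., b_t] *)
Definition bracket_sub a b : Prop :=
  size a = size b /\
  forall i, (1 <= i <= size a)%N ->
    ideal_gen (take i a) `<=` ideal_gen (take i b).

(* One-based indexing; the value is 0 beyond the length of a. *)
Definition entry a (h : nat) : R := nth 0 (0 :: a) h.

(* The index i - j + s + 1 is written i + s + 1 - j because subtraction on nat
   is truncated and j may exceed i; likewise i - u + s is written i + s - u. *)
Definition gamma_sum s (mu nu : seq R) (i : nat) : R :=
  \sum_(s + 1 <= j < (s + i).+1) entry mu j * entry nu (i + s + 1 - j).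

Definition gamma u s (mu nu : seq R) (i : nat) : R :=
  if (u - s + 1 <= i <= u)%N
  then entry mu (i + s - u) + gamma_sum s mu nu i
  else gamma_sum s mu nu i.

Definition gammas u s (mu nu : seq R) (n : nat) : seq R :=
  [seq gamma u s mu nu i | i <- iota 1 n].

End Ideals.

Definition noetherian (R : comPzRingType) : Prop :=
  forall I : set R, is_ideal I -> exists a : seq R, I = ideal_gen a.

(* Main.v *)
Require Import Defs.
From mathcomp Require Import all_boot all_order all_algebra.
From mathcomp Require Import boolp classical_sets.
From mathcomp Require Import zify.
Import GRing.Theory.
Local Open Scope classical_set_scope.
Local Open Scope ring_scope.

(** Both radicals are compared through a single radical ideal Q.

    Every gamma_i lies in I, and also in J because mu_1, ..., mu_s do, by the
    bracket hypothesis; this gives one inclusion.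

    For the other one, let Q be the radical of the ideal of the gamma_i.  Up to
    the extra term mu_t (t = i + s - u), gamma_i is the antidiagonal sum of the
    products mu_j nu_k with j > s and j + k = i + s + 1.  An induction on the
    pair (j, k), in lexicographic order, puts all the products mu_j nu_k with
    j > s in Q ([tail_product_in]).  Indeed multiply the gamma_i whose
    antidiagonal passes through (j, k) by mu_j nu_k: a summand mu_j' nu_k' with
    j' < j is already in Q, and one with j' > j has k' < k, so that
    mu_j nu_k' is already in Q.  The extra term has t < k and belongs to
    (nu_1, ..., nu_t), so that mu_j mu_t is in Q for the same reason.  Hence
    (mu_j nu_k)^2 is in Q, and so is mu_j nu_k.  Subtracting these products
    from gamma_(u-s+1), ..., gamma_u leaves mu_1, ..., mu_s in Q
    ([head_entry_in]).  So Q contains I J, hence the square of each element of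
    the intersection of I and J, hence that intersection. *)

(** * Ideals and radicals *)

Section IdealTheory.
Variable R : comPzRingType.
Implicit Types (I K : set R) (a : seq R).

Lemma ideal_gen_ideal a : is_ideal (ideal_gen a).
Proof.
split=> [K [[]]//|x y Ix Iy K Ka|r x Ix K Ka].
  by case: (Ka) => -[_ KD _] _; apply: KD; [apply: Ix|apply: Iy].
by case: (Ka) => -[_ _ KM] _; apply: KM; apply: Ix.
Qed.

Lemma mem_ideal_gen a x : x \in a -> ideal_gen a x.
Proof. by move=> ax K [_]; apply. Qed.

Lemma ideal_gen_sub a I :
  is_ideal I -> (forall x, x \in a -> I x) -> ideal_gen a `<=` I.
Proof. by move=> idI aI; apply: smallest_sub. Qed.

Lemma ideal_sum_nat I m n (F : nat -> R) : is_ideal I ->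
  (forall j, (m <= j < n)%N -> I (F j)) -> I (\sum_(m <= j < n) F j).
Proof. by case=> I0 ID _ FI; rewrite big_nat; apply: big_ind. Qed.

Lemma ideal_sub I x y : is_ideal I -> I (x + y) -> I y -> I x.
Proof.
case=> _ ID IM Ixy Iy; rewrite -[x](addrK y).
by apply: ID => //; rewrite -mulN1r; apply: IM.
Qed.

Lemma ideal_setI I K : is_ideal I -> is_ideal K -> is_ideal (I `&` K).
Proof.
move=> [I0 ID IM] [K0 KD KM]; split=> [//|x y [? ?] [? ?]|r x [? ?]].
  by split; [apply: ID|apply: KD].
by split; [apply: IM|apply: KM].
Qed.

Lemma radicalS I K : I `<=` K -> radical I `<=` radical K.
Proof. by move=> IK x [n n0 Ixn]; exists n => //; apply: IK. Qed.

Lemma sub_radical I : I `<=` radical I.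
Proof. by move=> x Ix; exists 1%N. Qed.

Lemma radical_exp I x n : (0 < n)%N -> radical I (x ^+ n) -> radical I x.
Proof.
move=> n0 [m m0 Ix]; exists (n * m)%N; first by rewrite muln_gt0 n0.
by rewrite exprM.
Qed.

Lemma radical_id I : radical (radical I) `<=` radical I.
Proof. by move=> x [n n0]; apply: radical_exp. Qed.

Lemma radical_ideal I : is_ideal I -> is_ideal (radical I).
Proof.
move=> idI; have [I0 ID IM] := idI.
split=> [|x y [n n0 Ix] [m m0 Iy]|r x [n n0 Ix]]; first exact: sub_radical.
  exists (n + m)%N; first by rewrite addn_gt0 n0.
  rewrite exprDn -(big_mkord xpredT
    (fun i => (x ^+ (n + m - i) * y ^+ i) *+ 'C(n + m, i))).
  apply: ideal_sum_nat => // i _; rewrite -mulr_natl; apply: (IM).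
  (* one of the two exponents n + m - i and i reaches n, respectively m *)
  have [im|mi] := leqP m i.
    by rewrite -(subnK im) exprD mulrA; apply: IM.
  have -> : (n + m - i = (m - i) + n)%N by lia.
  by rewrite exprD mulrAC; apply: IM.
by exists n => //; rewrite exprMn; apply: IM.
Qed.

Definition colon I K : set R := [set x | forall y, K y -> I (x * y)].

Lemma colon_ideal I K : is_ideal I -> is_ideal (colon I K).
Proof.
case=> I0 ID IM; split=> [y _|x z Ix Iz y Ky|r x Ix y Ky].
- by rewrite mul0r.
- by rewrite mulrDl; apply: ID; [apply: Ix|apply: Iz].
- by rewrite -mulrA; apply: IM; apply: Ix.
Qed.

(** Colon ideals are ideals, so membership of a product may be tested on
    generators, in one factor at a time. *)
Lemma mul_ideal_gen I a x : is_ideal I ->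
  (forall y, y \in a -> I (x * y)) -> forall y, ideal_gen a y -> I (x * y).
Proof.
move=> idI ax y ay; rewrite mulrC.
have aC : ideal_gen a `<=` colon I [set x].
  apply: ideal_gen_sub; first exact: colon_ideal.
  by move=> z az _ ->; rewrite mulrC; apply: ax.
exact: aC.
Qed.

Lemma mul_ideal_gens I a b : is_ideal I ->
  (forall x y, x \in a -> y \in b -> I (x * y)) ->
  forall x y, ideal_gen a x -> ideal_gen b y -> I (x * y).
Proof.
move=> idI abI x y ax by_; apply: (mul_ideal_gen I b) => // {by_} {}y by_.
rewrite mulrC; apply: (mul_ideal_gen I a) => // {ax} {}x ax.
by rewrite mulrC; apply: abI.
Qed.

(** * One-based entries *)

Lemma entry_default a h : (size a < h)%N -> entry a h = 0.
Proof. by move=> ah; rewrite /entry nth_default. Qed.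

Lemma entry_ideal_gen a h : ideal_gen a (entry a h).
Proof.
have [I0 _ _] := ideal_gen_ideal a.
case: h => [//|h]; have [ha|ah] := ltnP h (size a).
  by apply: mem_ideal_gen; apply: mem_nth.
by rewrite entry_default.
Qed.

Lemma entryP a x :
  x \in a -> exists2 h, (0 < h <= size a)%N & x = entry a h.
Proof.
move=> ax; exists (index x a).+1; first by rewrite /= index_mem.
by rewrite /entry /= nth_index.
Qed.

Lemma entry_take a h t : (h <= t)%N -> entry (take t a) h = entry a h.
Proof. by case: h => [//|h] ht; rewrite /entry /= nth_take. Qed.

Lemma bracket_sub_entry s (mu nu : seq R) t :
  (s <= size mu)%N -> bracket_sub (take s mu) (take s nu) ->
  (0 < t <= s)%N -> ideal_gen (take t nu) (entry mu t).
Proof.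
move=> smu [_ sub] /andP[t0 ts]; have := sub t.
rewrite size_takel // t0 ts !take_takel // => /(_ isT); apply.
by rewrite -(entry_take mu _ t) //; apply: entry_ideal_gen.
Qed.

(** * The elements gamma *)

Section Gamma.
Variables (s u v : nat) (mu nu : seq R).
Hypotheses (size_mu : size mu = u) (size_nu : size nu = v).
Hypotheses (su : (s < u)%N).
Hypothesis head_mu :
  forall t, (0 < t <= s)%N -> ideal_gen (take t nu) (entry mu t).

Lemma gamma_in_setI i : (ideal_gen mu `&` ideal_gen nu) (gamma u s mu nu i).
Proof.
have [_ ID IM] := ideal_gen_ideal mu; have [_ JD JM] := ideal_gen_ideal nu.
have sumI : (ideal_gen mu `&` ideal_gen nu) (gamma_sum s mu nu i).
  apply: ideal_sum_nat => [|j _].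
    by apply: ideal_setI; apply: ideal_gen_ideal.
  split; last by apply: JM; apply: entry_ideal_gen.
  by rewrite mulrC; apply: IM; apply: entry_ideal_gen.
rewrite /gamma; case: ifP => // iu; case: sumI => sumI sumJ.
split; first by apply: ID => //; apply: entry_ideal_gen.
apply: JD => //; have t_s : (0 < i + s - u <= s)%N by lia.
apply: (ideal_gen_sub _ _ _ _ _ (head_mu _ t_s)).
  exact: ideal_gen_ideal.
by move=> x /mem_take; apply: mem_ideal_gen.
Qed.

Variable Q : set R.
Hypothesis idQ : is_ideal Q.
Hypothesis radQ : radical Q `<=` Q.
Variable n : nat.
Hypotheses (un : (u <= n)%N) (uvn : (u + v - s - 1 <= n)%N).
Hypothesis gammaQ : forall i, (0 < i <= n)%N -> Q (gamma u s mu nu i).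

(** Lexicographic induction along the antidiagonals: the square of the product
    is congruent modulo Q to a multiple of gamma_(j+k-s-1). *)
Lemma tail_product_in j k : (s < j)%N -> Q (entry mu j * entry nu k).
Proof.
have [Q0 QD QM] := idQ.
elim/ltn_ind: j k => j IHj; elim/ltn_ind=> k IHk sj.
have [uj|ju] := ltnP u j.
  by rewrite entry_default ?size_mu // mul0r.
have [vk|kv] := ltnP v k.
  by rewrite [entry nu k]entry_default ?size_nu // mulr0.
have [->|k0] := posnP k; first by rewrite /entry /= mulr0.
set p := entry mu j * entry nu k; set i := (j + k - s - 1)%N.
have Qgamma : Q (gamma_sum s mu nu i * p).
  have : Q (p * gamma u s mu nu i) by apply/QM/gammaQ; lia.
  rewrite mulrC /gamma; case: ifP => // iu.
  rewrite mulrDl addrC => /(ideal_sub _ _ _ idQ); apply.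
  rewrite mulrC /p mulrAC mulrC; apply: QM.
  have t_s : (0 < i + s - u <= s)%N by lia.
  apply: (mul_ideal_gen _ _ _ idQ _ _ (head_mu _ t_s)) => _ /entryP[k' k't ->].
  (* t = j + k - 1 - u < k because j <= u, hence k' < k *)
  have {}k't : (k' <= i + s - u)%N.
    by move: k't; rewrite size_take; case: ifP; lia.
  by rewrite entry_take //; apply: IHk => //; lia.
apply: radQ; exists 2%N => //; rewrite expr2.
have ij : (i + s + 1 - j = k)%N by lia.
move: Qgamma; rewrite /gamma_sum (bigD1_seq j) ?iota_uniq //=; last first.
  by rewrite mem_index_iota; lia.
rewrite ij -/p mulrDl => /(ideal_sub _ _ _ idQ); apply.
rewrite big_distrl big_mkcond; apply: ideal_sum_nat => // j' j'i /=.
case: ifP => // j'j; have [{}j'j|jj'] := ltnP j' j.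
  by rewrite mulrC; apply/QM/IHj; lia.
set k' := (i + s + 1 - j')%N.
rewrite /p [entry mu j' * _]mulrC mulrACA mulrC; apply: QM.
by rewrite mulrC; apply: IHk; lia.
Qed.

(** The antidiagonal part of gamma_(u-s+t) is in Q by the previous lemma. *)
Lemma head_entry_in t : (0 < t <= s)%N -> Q (entry mu t).
Proof.
move=> ts; have /gammaQ : (0 < u - s + t <= n)%N by lia.
rewrite /gamma ifT; last by lia.
have -> : (u - s + t + s - u = t)%N by lia.
move=> /(ideal_sub _ _ _ idQ); apply.
by apply: ideal_sum_nat => // j sj; apply: tail_product_in; lia.
Qed.

(** The square of an element of both ideals is a combination of products
    mu_j nu_k, all of which belong to Q. *)
Lemma setI_in : ideal_gen mu `&` ideal_gen nu `<=` Q.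
Proof.
have [_ _ QM] := idQ.
move=> x [Ix Jx]; apply: radQ; exists 2%N => //; rewrite expr2.
apply: (mul_ideal_gens _ _ _ idQ _ _ _ Ix Jx).
move=> _ _ /entryP[j jmu ->] /entryP[k _ ->].
have [js|sj] := leqP j s; last exact: tail_product_in.
by rewrite mulrC; apply/QM/head_entry_in; lia.
Qed.

End Gamma.

(** The bounds on n treat both cases of the theorem at once: u + v - s - 1 is
    the last index whose antidiagonal meets both sequences, u is the index of
    the gamma_i that contains mu_s, and u + v - s - 1 <= u exactly when
    v <= s + 1. *)
Lemma radical_setI_gammas (mu nu : seq R) u v s n :
  size mu = u -> size nu = v -> (s < u)%N ->
  bracket_sub (take s mu) (take s nu) ->
  (u <= n)%N -> (u + v - s - 1 <= n)%N ->
  radical (ideal_gen mu `&` ideal_gen nu) =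
  radical (ideal_gen (gammas u s mu nu n)).
Proof.
move=> size_mu size_nu su sub un uvn.
have head_mu t : (0 < t <= s)%N -> ideal_gen (take t nu) (entry mu t).
  by move=> ts; apply: (bracket_sub_entry s) => //; rewrite size_mu ltnW.
apply/seteqP; split; last first.
  apply: radicalS; apply: ideal_gen_sub.
    by apply: ideal_setI; apply: ideal_gen_ideal.
  by move=> _ /mapP[i _ ->]; apply: (gamma_in_setI s u v).
move=> x Ix; apply: radical_id; apply: radicalS Ix.
apply: (setI_in s u v mu nu size_mu size_nu su head_mu _ _ _ n un uvn).
- by apply: radical_ideal; apply: ideal_gen_ideal.
- exact: radical_id.
- move=> i i_n; apply: sub_radical; apply: mem_ideal_gen.
  by apply: map_f; rewrite mem_iota; lia.
Qed.

End IdealTheory.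

Theorem theorem1 (R : comPzRingType) (hR : noetherian R)
  (u v s : nat) (mu : u.-tuple R) (nu : v.-tuple R)
  (hs0 : (0 < s)%N) (hsu : (s < u)%N) (hsv : (s <= v)%N)
  (hsub : bracket_sub (take s mu) (take s nu)) :
  ((s + 2 <= v)%N ->
     radical (ideal_gen mu `&` ideal_gen nu) =
     radical (ideal_gen (gammas u s mu nu (u + v - s - 1)))) /\
  ((v <= s + 1)%N -> (s <= v)%N ->
     radical (ideal_gen mu `&` ideal_gen nu) =
     radical (ideal_gen (gammas u s mu nu u))).
Proof.
by split=> [sv|vs _]; apply: (radical_setI_gammas R mu nu u v s);
  rewrite ?size_tuple //; lia.
Qed.
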